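(* Let $R$ and $S$ be local Noetherian rings with infinite residue field, let $K$ be an $S$-module, let $C$ be a multiplicatively closed subset of nonzerodivisors of $S$ that are also nonzerodivisors on $K$, and suppose that $R$ is a subring of $S$ that is twisted by $K$ along $C$. Let $I$ be an ideal of $R$ contracted from $S$ and meeting $C$. If $J$ is a minimal reduction of $IS$ and $n\ge 0$ is an integer such that $I^{n+1}S=JI^nS$, then there exists a minimal reduction $J'$ of $I$ such that $I^{n+2}=J'I^{n+1}$, and $$r_S(IS)\le r_R(I)\le r_S(IS)+1.$$
   Context: All rings are commutative with identity. An ideal $I$ of a subring $R\subseteq S$ is contracted from $S$ if $I=IS\cap R$; it meets $C$ if $I\cap C\neq\emptyset$. For an ideal $I$ of a ring $A$, an ideal $J\subseteq I$ is a reduction of $I$ if $I^{n+1}=JI^n$ for some $n>0$; the reduction number of $I$ with respect to $J$ is the smallest integer $n\ge 0$ with $I^{n+1}=JI^n$ (where $I^0=A$). A reduction $J$ of $I$ is minimal if $J$ itself has no proper reduction. For $A$ local Noetherian, $r_A(I)$ denotes the minimum of the reduction numbers of $I$ with respect to its minimal reductions. A derivation $D:B\to L$ from a ring $B$ to a $B$-module $L$ is an additive map with $D(st)=sD(t)+tD(s)$; $\ker D$ is its additive kernel. Twisted subring: let $S$ be a ring, $K$ an $S$-module, $C$ a multiplicatively closed subset of nonzerodivisors of $S$ that are also nonzerodivisors on $K$, and view $S\subseteq S_C$, $K\subseteq K_C$ (localizations at $C$). A subring $R$ of $S$ is twisted by $K$ along $C$ if there is a derivation $D:S_C\to K_C$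 with $D(c)=0$ for all $c\in C$ such that (a) $R=S\cap D^{-1}(K)$; (b) $D(S_C)$ generates $K_C$ as an $S_C$-module; (c) $S\subseteq \ker D+cS$ for all $c\in C$. In particular $C\subseteq R$. *)

(* Defs.v *)
From HB Require Import structures.
From mathcomp Require Import all_boot all_algebra.
From mathcomp Require Import ring.
From mathcomp Require Import boolp classical_sets functions cardinality.

Set Implicit Arguments.
Unset Strict Implicit.
Unset Printing Implicit Defensive.

Import GRing.Theory.
Local Open Scope classical_set_scope.
Local Open Scope ring_scope.
Local Open Scope quotient_scope.

Section Submodules.
Variables (A : comPzRingType) (V : lmodType A).

Definition is_submodule (M : set V) : Prop :=
  [/\ M 0,
      forall x y, M x -> M y -> M (x + y) &
      forall a x, M x -> M (a *: x)].

Definition submodule_span (X : set V) : set V := smallest is_submodule X.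

End Submodules.

Section Ideals.
Variable A : comNzRingType.
Implicit Types I J m : set A.

Definition is_ideal I : Prop := is_submodule (I : set A^o).

Definition ideal_span (X : set A) : set A := submodule_span (X : set A^o).

Definition ideal_mul I J : set A :=
  ideal_span [set x | exists y z, [/\ I y, J z & x = y * z]].

Fixpoint ideal_exp I (n : nat) : set A :=
  if n is n'.+1 then ideal_mul I (ideal_exp I n') else setT.

Definition maximal_ideal m : Prop :=
  [/\ is_ideal m, m <> setT &
      forall I, is_ideal I -> m `<=` I -> I = m \/ I = setT].

Definition local_ring : Prop := exists! m, maximal_ideal m.

Definition noetherian_ring : Prop :=
  forall I, is_ideal I -> exists s : seq A, I = ideal_span [set` s].

Definition ideal_coset m (x : A) : set A := [set y | m (y - x)].

Definition infinite_residue_field : Prop :=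
  forall m, maximal_ideal m -> infinite_set (range (ideal_coset m)).

Definition reduction J I : Prop :=
  [/\ is_ideal J, J `<=` I &
      exists2 n, (0 < n)%N & ideal_exp I n.+1 = ideal_mul J (ideal_exp I n)].

Definition minimal_reduction J I : Prop :=
  reduction J I /\ forall J', reduction J' J -> J' = J.

(* The smallest element of P; the value on the empty set is irrelevant. *)
Definition least (P : set nat) : nat :=
  xget 0%N [set n | P n /\ forall k, P k -> (n <= k)%N].

Definition reduction_number_wrt J I : nat :=
  least [set n | ideal_exp I n.+1 = ideal_mul J (ideal_exp I n)].

(* Over a local Noetherian ring every ideal has a minimal reduction, so the
   minimum is taken over a nonempty set. *)
Definition reduction_number I : nat :=
  least [set reduction_number_wrt J I | J in [set J | minimal_reduction J I]].

End Ideals.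

Section Extension.
Variables (S : comNzRingType) (P : {pred S}) (R : GRing.SubComNzRing.type P).

Definition ideal_ext (I : set R) : set S := ideal_span [set val x | x in I].

Definition contracted (I : set R) : Prop := I = val @^-1` ideal_ext I.

End Extension.

Section ModuleLocalization.
Variables (A : comNzRingType) (C : mulrClosed A) (K : lmodType A).
Implicit Types (x y : K).

Definition denom := {c : A | c \in C}.

Definition denom1 : denom := exist _ 1 (rpred1 _).
Definition denomM (c d : denom) : denom :=
  exist _ (sval c * sval d) (rpredM (valP c) (valP d)).

Definition frac_rel (p q : K * denom) : bool :=
  `[< exists2 u, u \in C & u *: (sval q.2 *: p.1) = u *: (sval p.2 *: q.1) >].

Fact frac_rel_refl : reflexive frac_rel.
Proof. by move=> p; apply/asboolP; exists 1; rewrite ?rpred1. Qed.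

Fact frac_rel_sym : symmetric frac_rel.
Proof.
have H p q : frac_rel p q -> frac_rel q p.
  by move=> /asboolP[u uC e]; apply/asboolP; exists u.
by move=> p q; apply/idP/idP; exact: H.
Qed.

Fact frac_rel_trans : transitive frac_rel.
Proof.
move=> [y d] [x c] [z e] /asboolP[u uC /= h1] /asboolP[v vC /= h2].
apply/asboolP; exists (u * v * sval d) => /=.
  by rewrite !rpredM// (valP d).
have h1' : (v * sval e) *: (u *: (sval d *: x)) =
           (v * sval e) *: (u *: (sval c *: y)) by rewrite h1.
have h2' : (u * sval c) *: (v *: (sval e *: y)) =
           (u * sval c) *: (v *: (sval d *: z)) by rewrite h2.
move: h1' h2'; rewrite !scalerA => h1' h2'.
transitivity ((v * sval e * u * sval d) *: x); first by congr (_ *: _); ring.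
rewrite h1'; transitivity ((u * sval c * v * sval e) *: y).
  by congr (_ *: _); ring.
by rewrite h2'; congr (_ *: _); ring.
Qed.

Canonical frac_equiv :=
  EquivRel frac_rel frac_rel_refl frac_rel_sym frac_rel_trans.

(* The localization K_C, as the quotient of K x C by frac_rel. *)
Definition modloc := {eq_quot frac_rel}.

HB.instance Definition _ : EqQuotient _ frac_rel modloc := EqQuotient.on modloc.
HB.instance Definition _ := Choice.on modloc.

Definition frac x (c : denom) : modloc := \pi_modloc (x, c).

Lemma fracP x y (c d : denom) : frac x c = frac y d <->
  exists2 u, u \in C & u *: (sval d *: x) = u *: (sval c *: y).
Proof.
split=> [/eqmodP/asboolP//|h]; apply/eqmodP; exact/asboolP.
Qed.

Definition num (p : modloc) : K := (repr p).1.
Definition den (p : modloc) : denom := (repr p).2.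

Lemma frac_numden p : frac (num p) (den p) = p.
Proof. by rewrite /frac -surjective_pairing reprK. Qed.

Lemma fracW (Q : modloc -> Prop) : (forall x c, Q (frac x c)) -> forall p, Q p.
Proof. by move=> h p; rewrite -(frac_numden p). Qed.

Definition modloc_zero : modloc := frac 0 denom1.
Definition modloc_opp (p : modloc) : modloc := frac (- num p) (den p).
Definition modloc_add (p q : modloc) : modloc :=
  frac (sval (den q) *: num p + sval (den p) *: num q) (denomM (den p) (den q)).

Lemma modloc_oppE x c : modloc_opp (frac x c) = frac (- x) c.
Proof.
have /fracP[u uC e] := frac_numden (frac x c).
by apply/fracP; exists u; rewrite // !scalerN e.
Qed.

Lemma modloc_addE x y c d : modloc_add (frac x c) (frac y d) =
  frac (sval d *: x + sval c *: y) (denomM c d).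
Proof.
have /fracP[u uC e] := frac_numden (frac x c).
have /fracP[v vC f] := frac_numden (frac y d).
apply/fracP; exists (u * v); first exact: rpredM.
move: e f; rewrite /=.
move: (num _) (num _) (den _) (den _) => y' x' d' c' e f.
rewrite !scalerDr !scalerA; congr (_ + _).
  transitivity ((v * sval d * sval d') *: (u *: (sval c *: x'))).
    by rewrite !scalerA; congr (_ *: _); ring.
  by rewrite e !scalerA; congr (_ *: _); ring.
transitivity ((u * sval c * sval c') *: (v *: (sval d *: y'))).
  by rewrite !scalerA; congr (_ *: _); ring.
by rewrite f !scalerA; congr (_ *: _); ring.
Qed.

Lemma eq_frac x y (c d : denom) : sval d *: x = sval c *: y -> frac x c = frac y d.
Proof. by move=> e; apply/fracP; exists 1; rewrite ?rpred1 ?e. Qed.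

Fact modloc_addA : associative modloc_add.
Proof.
elim/fracW=> x c; elim/fracW=> y d; elim/fracW=> z e; rewrite !modloc_addE.
apply: eq_frac; rewrite /= !(scalerDr, scalerA) -addrA.
by congr (_ *: _ + (_ *: _ + _ *: _)); ring.
Qed.

Fact modloc_addC : commutative modloc_add.
Proof.
elim/fracW=> x c; elim/fracW=> y d; rewrite !modloc_addE.
apply: eq_frac; rewrite /= !(scalerDr, scalerA) addrC.
by congr (_ *: _ + _ *: _); ring.
Qed.

Fact modloc_add0 : left_id modloc_zero modloc_add.
Proof.
elim/fracW=> x c; rewrite !modloc_addE.
by apply: eq_frac; rewrite /= scaler0 add0r scalerA !mul1r mulr1.
Qed.

Fact modloc_addN : left_inverse modloc_zero modloc_opp modloc_add.
Proof.
elim/fracW=> x c; rewrite modloc_oppE modloc_addE.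
by apply: eq_frac; rewrite /= scalerN addNr !scaler0.
Qed.

HB.instance Definition _ := GRing.isZmodule.Build modloc
  modloc_addA modloc_addC modloc_add0 modloc_addN.

Lemma frac_add x y c d :
  frac x c + frac y d = frac (sval d *: x + sval c *: y) (denomM c d).
Proof. exact: modloc_addE. Qed.

Definition to_modloc x : modloc := frac x denom1.

End ModuleLocalization.

Section ModlocScale.
Variables (A : comNzRingType) (C : mulrClosed A) (K : lmodType A).

Definition modloc_scale (p : modloc C A^o) (q : modloc C K) : modloc C K :=
  frac ((num p : A) *: num q) (denomM (den p) (den q)).

Lemma modloc_scaleE (a : A^o) (x : K) (c d : denom C) :
  modloc_scale (frac a c) (frac x d) = frac ((a : A) *: x) (denomM c d).
Proof.
have /fracP[u uC] := frac_numden (frac a c).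
have /fracP[v vC] := frac_numden (frac x d).
rewrite /modloc_scale.
move: (num _) (num _) (den _) (den _) => a' x' c' d' e f.
apply/fracP; exists (u * v); first exact: rpredM.
rewrite /= !scalerA.
transitivity ((u * (sval c * (a' : A))) *: (v *: (sval d *: x'))).
  by rewrite !scalerA; congr (_ *: _); ring.
rewrite (f : u * (sval c * a') = u * (sval c' * a)) e !scalerA.
by congr (_ *: _); ring.
Qed.

End ModlocScale.

Section RingLocalization.
Variables (A : comNzRingType) (C : mulrClosed A).

(* The localization S_C. *)
Definition loc := modloc C A^o.

HB.instance Definition _ := GRing.Zmodule.on loc.

Definition locfrac (a : A) (c : denom C) : loc := @frac A C A^o a c.

Lemma locfracW (Q : loc -> Prop) : (forall a c, Q (locfrac a c)) -> forall p, Q p.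
Proof. by move=> h p; apply: (@fracW A C A^o Q). Qed.

Lemma locfracP (a b : A) (c d : denom C) : locfrac a c = locfrac b d <->
  exists2 u, u \in C & u * (sval d * a) = u * (sval c * b).
Proof. exact: fracP. Qed.

Lemma eq_locfrac (a b : A) (c d : denom C) :
  sval d * a = sval c * b -> locfrac a c = locfrac b d.
Proof. exact: (@eq_frac A C A^o). Qed.

Lemma locfrac_add (a b : A) (c d : denom C) : locfrac a c + locfrac b d =
  locfrac (sval d * a + sval c * b) (denomM c d).
Proof. exact: (@frac_add A C A^o). Qed.

Definition loc_mul : loc -> loc -> loc := @modloc_scale A C A^o.

Fact loc_mulE (a b : A) (c d : denom C) :
  loc_mul (locfrac a c) (locfrac b d) = locfrac (a * b) (denomM c d).
Proof. exact: (@modloc_scaleE A C A^o). Qed.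

Fact loc_mulA : associative loc_mul.
Proof.
elim/locfracW=> x c; elim/locfracW=> y d; elim/locfracW=> z e; rewrite !loc_mulE.
by apply: eq_locfrac => /=; ring.
Qed.

Fact loc_mulC : commutative loc_mul.
Proof.
elim/locfracW=> x c; elim/locfracW=> y d; rewrite !loc_mulE.
by apply: eq_locfrac => /=; ring.
Qed.

Fact loc_mul1 : left_id (locfrac 1 (denom1 C)) loc_mul.
Proof.
elim/locfracW=> x c; rewrite loc_mulE.
by apply: eq_locfrac => /=; ring.
Qed.

Fact loc_mulDl : left_distributive loc_mul +%R.
Proof.
elim/locfracW=> x c; elim/locfracW=> y d; elim/locfracW=> z e.
rewrite locfrac_add !loc_mulE locfrac_add.
by apply: eq_locfrac => /=; ring.
Qed.

HB.instance Definition _ := GRing.Zmodule_isComPzRing.Build loc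
  loc_mulA loc_mulC loc_mul1 loc_mulDl.

Lemma locfrac_mul (a b : A) (c d : denom C) :
  locfrac a c * locfrac b d = locfrac (a * b) (denomM c d).
Proof. exact: loc_mulE. Qed.

Definition to_loc (a : A) : loc := locfrac a (denom1 C).

Variable K : lmodType A.
Local Notation KC := (modloc C K).

Definition loc_scale (p : loc) (v : KC) : KC := modloc_scale p v.

Fact loc_scaleE (a : A) (x : K) (c d : denom C) :
  loc_scale (locfrac a c) (frac x d) = frac (a *: x) (denomM c d).
Proof. exact: modloc_scaleE. Qed.

Fact loc_scaleA (p q : loc) (v : KC) :
  loc_scale p (loc_scale q v) = loc_scale (p * q) v.
Proof.
elim/locfracW: p => x c; elim/locfracW: q => y d; elim/fracW: v => z e.
rewrite locfrac_mul !loc_scaleE.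
by apply: eq_frac; rewrite /= !scalerA; congr (_ *: _); ring.
Qed.

Fact loc_scale1 : left_id (1 : loc) loc_scale.
Proof.
elim/fracW=> z e; rewrite [1]/(locfrac 1 (denom1 C)) loc_scaleE.
by apply: eq_frac; rewrite /= !scalerA; congr (_ *: _); ring.
Qed.

Fact loc_scaleDr : right_distributive loc_scale +%R.
Proof.
elim/locfracW=> x c; elim/fracW=> y d; elim/fracW=> z e.
rewrite frac_add !loc_scaleE frac_add.
apply: eq_frac; rewrite /= !(scalerDr, scalerA).
by congr (_ *: _ + _ *: _); ring.
Qed.

Fact loc_scaleDl (v : KC) : {morph loc_scale^~ v : p q / p + q}.
Proof.
elim/locfracW=> x c; elim/locfracW=> y d; elim/fracW: v => z e.
rewrite locfrac_add !loc_scaleE frac_add.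
apply: eq_frac; rewrite /= !scalerA -scalerDl !scalerA.
by congr (_ *: _); ring.
Qed.

HB.instance Definition _ := GRing.Zmodule_isLmodule.Build loc KC
  loc_scaleA loc_scale1 loc_scaleDr loc_scaleDl.

Lemma locfrac_scale (a : A) (x : K) (c d : denom C) :
  locfrac a c *: frac x d = frac (a *: x) (denomM c d) :> KC.
Proof. exact: loc_scaleE. Qed.

End RingLocalization.

Definition derivation (B : comPzRingType) (L : lmodType B) (D : B -> L) : Prop :=
  (forall s t, D (s + t) = D s + D t) /\
  (forall s t, D (s * t) = s *: D t + t *: D s).

Section Twisted.
Variables (S : comNzRingType) (K : lmodType S) (C : mulrClosed S).

(* The subring is given by its membership predicate P. *)
Definition twisted_along (P : {pred S}) (D : loc C -> modloc C K) : Prop :=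
  [/\ derivation D,
      forall c, c \in C -> D (to_loc C c) = 0,
      forall s, s \in P <-> exists k, D (to_loc C s) = to_modloc C k,
      submodule_span (range D) = setT &
      forall c, c \in C -> forall s, exists x t,
        D x = 0 /\ to_loc C s = x + to_loc C (c * t)].

Definition twisted (P : {pred S}) : Prop := exists D, twisted_along P D.

End Twisted.

(* Main.v *)
Require Import Defs.
From HB Require Import structures.
From mathcomp Require Import all_boot all_algebra.
From mathcomp Require Import ring zify.
From mathcomp Require Import boolp classical_sets functions cardinality.

Set Implicit Arguments.
Unset Strict Implicit.
Unset Printing Implicit Defensive.

Import GRing.Theory.
Local Open Scope classical_set_scope.
Local Open Scope ring_scope.

(** Let [A] be the ring of constants of the twisting derivation [D] in [S], so
    that [C <= A <= R]. The derivation enters only through four facts: [S] is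
    [A + c S] for every [c] in [C] (density); an element of [S] with a multiple
    [c x] in [A] lies in [A]; [c S] meets [R] in a set on which a product of
    two elements is [c] times a third one; and an element of [R] invertible in
    [S] is invertible in [R]. Fix [c] in both [I] and [C], and suppose [I]
    proper, so that [c] lies in both maximal ideals (for the unit ideal all
    reduction numbers vanish).

    Density splits every [y] in [I] as [a + u] with [a] in [I] and [A], and [u]
    in [I] and [c S]. As the product of two errors [u] is [c] times an error,
    [I ^ 2] is [b I], where [b] is generated by the elements of [I] in [A]
    ([contracted_sqr]), and so [I ^ (n + 2)] is generated by products [p z]
    with [z] in [I] and [p] in [b ^ (n + 1)] and [A].

    Let [J] be a minimal reduction of [I S]. It contains a power of [c], so
    density moves a minimal set of generators of [J] into [A] while changing
    them only by elements of [m J], and by Nakayama's lemma the new elements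
    still generate [J]. Let [J'] be the ideal of [R] that they generate
    ([lift_generators]). From [I ^ (n + 1) S = J I ^ n S], each [p] as above
    lies in [J' b ^ n + c ^ (n + 2) R]; hence [I ^ (n + 2)] is contained in
    [J' I ^ (n + 1) + I I ^ (n + 2)] and Nakayama's lemma gives
    [I ^ (n + 2) = J' I ^ (n + 1)] ([reduction_descent]). A reduction [M] of
    [J'] satisfies [M S = J], hence agrees with [J'] modulo [J' cap m_S J]; the
    latter is [m_R J'] because the generators are minimal, so [M = J']. This
    proves the first claim and the upper bound ([reduction_lift]).

    For the lower bound it suffices that [J S] is a minimal reduction of [I S]
    whenever [J] is one of [I] ([reduction_ext_minimal]). A reduction [L] of
    [J S] contains a power of [c], and is therefore extended from
    [Z = J cap L]. Writing elements of [J ^ (q + 1)] as elements of [Z J ^ q]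
    plus errors in [c ^ k S], the product of two errors lies in
    [c ^ k I <= I ^ (k + 1)], which for large [k] is inside a high power of [J].
    So [Z] is a reduction of [J], whence [Z = J] and [L = J S]. *)

(** * Ideals, their products and powers *)

Section IdealAlgebra.
Variable A : comNzRingType.
Implicit Types (I J K N X Y : set A) (x y z : A).

Lemma ideal0 I : is_ideal I -> I 0. Proof. by case. Qed.

Lemma idealD I x y : is_ideal I -> I x -> I y -> I (x + y).
Proof. by case=> _ + _; apply. Qed.

Lemma idealM I a x : is_ideal I -> I x -> I (a * x).
Proof. by case=> _ _; apply. Qed.

Lemma idealB I x y : is_ideal I -> I x -> I y -> I (x - y).
Proof.
move=> idI Ix Iy; apply: idealD => //.
by rewrite -mulN1r; apply: idealM.
Qed.

Lemma ideal_sum I n (f : 'I_n -> A) :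
  is_ideal I -> (forall i, I (f i)) -> I (\sum_i f i).
Proof.
move=> idI If; elim/big_ind: _ => //; first exact: ideal0.
by move=> x y; apply: idealD.
Qed.

Lemma idealT : is_ideal (setT : set A).
Proof. by split. Qed.

Lemma ideal_eqT I : is_ideal I -> I 1 -> I = setT.
Proof.
move=> idI I1; apply/seteqP; split=> // x _.
by rewrite -(mulr1 x); apply: idealM.
Qed.

Lemma span_ideal X : is_ideal (ideal_span X).
Proof.
split=> [M [[]]//|x y Xx Xy M MX|a x Xx M MX].
  by case: (MX.1) => _ + _; apply; [apply: Xx|apply: Xy].
by case: (MX.1) => _ _; apply; apply: Xx.
Qed.

Lemma sub_ideal_span X : X `<=` ideal_span X.
Proof. exact: sub_gen_smallest. Qed.

Lemma ideal_span_sub X I : is_ideal I -> X `<=` I -> ideal_span X `<=` I.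
Proof. exact: smallest_sub. Qed.

Lemma ideal_colon K z : is_ideal K -> is_ideal [set x | K (x * z)].
Proof.
move=> idK; split=> /= [|x y Kx Ky|a x Kx].
- by rewrite mul0r; apply: ideal0.
- by rewrite mulrDl; apply: idealD.
- by rewrite -mulrA; apply: idealM.
Qed.

Lemma span_mul_sub X Y K : is_ideal K ->
  (forall x y, X x -> Y y -> K (x * y)) ->
  forall x y, ideal_span X x -> ideal_span Y y -> K (x * y).
Proof.
move=> idK KXY x y; move: x y.
have KX x y : X x -> ideal_span Y y -> K (x * y).
  move=> Xx; rewrite mulrC; apply: (ideal_span_sub (ideal_colon x idK)) => z Yz /=.
  by rewrite mulrC; apply: KXY.
move=> x y Xx Yy; apply: (ideal_span_sub (ideal_colon y idK)) Xx => z Xz /=.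
exact: KX.
Qed.

Lemma mul_ideal I J : is_ideal (ideal_mul I J).
Proof. exact: span_ideal. Qed.

Lemma mem_mul I J x y : I x -> J y -> ideal_mul I J (x * y).
Proof. by move=> Ix Jy; apply: sub_ideal_span; exists x, y. Qed.

Lemma mul_sub I J K : is_ideal K ->
  (forall x y, I x -> J y -> K (x * y)) -> ideal_mul I J `<=` K.
Proof. by move=> idK h; apply: ideal_span_sub => // _ [x [y [Ix Jy ->]]]; apply: h. Qed.

Lemma mul_mono I J I' J' : I `<=` I' -> J `<=` J' ->
  ideal_mul I J `<=` ideal_mul I' J'.
Proof.
move=> II JJ; apply: mul_sub (mul_ideal _ _) _ => x y /II ? /JJ ?.
exact: mem_mul.
Qed.

Lemma mul_subr I J : is_ideal J -> ideal_mul I J `<=` J.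
Proof. by move=> idJ; apply: mul_sub => // x y _; apply: idealM. Qed.

Lemma mulC_ideal I J : ideal_mul I J = ideal_mul J I.
Proof.
by apply/seteqP; split; apply: mul_sub (mul_ideal _ _) _ => x y Ix Jy;
  rewrite mulrC; apply: mem_mul.
Qed.

Lemma mul_subl I J : is_ideal I -> ideal_mul I J `<=` I.
Proof. by rewrite mulC_ideal; apply: mul_subr. Qed.

Lemma mulA_ideal I J K :
  ideal_mul I (ideal_mul J K) = ideal_mul (ideal_mul I J) K.
Proof.
have H I1 J1 K1 :
    ideal_mul (ideal_mul I1 J1) K1 `<=` ideal_mul I1 (ideal_mul J1 K1).
  apply: mul_sub (mul_ideal _ _) _ => x z IJx Kz.
  apply: (mul_sub (ideal_colon z (mul_ideal _ _))) IJx => u v Iu Jv /=.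
  by rewrite -mulrA; apply: mem_mul => //; apply: mem_mul.
apply/seteqP; split; last exact: H.
rewrite mulC_ideal (mulC_ideal J) (mulC_ideal (ideal_mul I J)) (mulC_ideal I).
exact: H.
Qed.

Lemma mulCA_ideal I J K :
  ideal_mul I (ideal_mul J K) = ideal_mul J (ideal_mul I K).
Proof. by rewrite !mulA_ideal (mulC_ideal I). Qed.

Lemma mul1_ideal I : is_ideal I -> ideal_mul setT I = I.
Proof.
move=> idI; apply/seteqP; split; first exact: mul_subr.
by move=> x Ix; rewrite -(mul1r x); apply: mem_mul.
Qed.

Lemma exp_ideal I n : is_ideal (ideal_exp I n).
Proof. by case: n => [|n]; [apply: idealT|apply: mul_ideal]. Qed.

Lemma expD_ideal I m n :
  ideal_exp I (m + n) = ideal_mul (ideal_exp I m) (ideal_exp I n).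
Proof.
elim: m => [|m IH] /=; first by rewrite mul1_ideal //; apply: exp_ideal.
by rewrite IH mulA_ideal.
Qed.

Lemma mem_exp I x n : I x -> ideal_exp I n (x ^+ n).
Proof. by move=> Ix; elim: n => //= n IH; rewrite exprS; apply: mem_mul. Qed.

Lemma exp_mono I J n : I `<=` J -> ideal_exp I n `<=` ideal_exp J n.
Proof. by move=> IJ; elim: n => //= n IH; apply: mul_mono. Qed.

Lemma exp_antitone I m n : (m <= n)%N -> ideal_exp I n `<=` ideal_exp I m.
Proof. by move=> /subnK <-; rewrite expD_ideal; apply: mul_subr; apply: exp_ideal. Qed.

Lemma expT_ideal n : ideal_exp (setT : set A) n = setT.
Proof. by elim: n => //= n ->; apply: mul1_ideal idealT. Qed.

Definition ideal_add I J : set A :=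
  [set x | exists y z, [/\ I y, J z & x = y + z]].

Lemma add_ideal I J : is_ideal I -> is_ideal J -> is_ideal (ideal_add I J).
Proof.
move=> idI idJ; split=> [|_ _ [y [z [? ? ->]]] [y' [z' [? ? ->]]]|a _ [y [z [? ? ->]]]].
- by exists 0, 0; rewrite addr0; split=> //; apply: ideal0.
- exists (y + y'), (z + z'); split; [exact: idealD..|ring].
- exists (a * y), (a * z); split; [exact: idealM..|].
  by rewrite -[a *: _]/(a * _) mulrDr.
Qed.

Lemma add_subl I J : is_ideal J -> I `<=` ideal_add I J.
Proof. by move=> idJ x Ix; exists x, 0; rewrite addr0; split=> //; apply: ideal0. Qed.

Lemma add_subr I J : is_ideal I -> J `<=` ideal_add I J.
Proof. by move=> idI x Jx; exists 0, x; rewrite add0r; split=> //; apply: ideal0. Qed.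

Lemma principal_ideal g : is_ideal [set a * g | a in [set: A]].
Proof.
split=> [|_ _ [a _ <-] [b _ <-]|b _ [a _ <-]].
- by exists 0; rewrite ?mul0r.
- by exists (a + b); rewrite ?mulrDl.
- by exists (b * a); rewrite -?mulrA.
Qed.

Lemma span_cons_sub (g : A) (s : seq A) : ideal_span [set` g :: s] `<=`
  ideal_add (ideal_span [set` s]) [set a * g | a in setT].
Proof.
have idg := principal_ideal g.
have ids : is_ideal (ideal_span [set` s]) by exact: span_ideal.
apply: ideal_span_sub; first exact: add_ideal.
move=> x /=; rewrite inE => /orP[/eqP->|xs].
  by apply: add_subr => //; exists 1; rewrite ?mul1r.
by apply: add_subl => //; apply: sub_ideal_span.
Qed.

Lemma span_range n (g : 'I_n -> A) :
  ideal_span (range g) = [set x | exists a : 'I_n -> A, x = \sum_i a i * g i].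
Proof.
apply/seteqP; split=> [|_ [a ->]]; last first.
  apply: ideal_sum (span_ideal _) _ => i.
  by apply: idealM (span_ideal _) _; apply: sub_ideal_span; exists i.
apply: ideal_span_sub => [|_ [i _ <-]]; last first.
  exists (fun j => (j == i)%:R); rewrite (bigD1 i)//= eqxx mul1r big1 ?addr0//.
  by move=> j /negPf->; rewrite mul0r.
split=> [|_ _ [a ->] [b ->]|b _ [a ->]].
- by exists (fun=> 0); rewrite big1// => i _; rewrite mul0r.
- exists (fun i => a i + b i); rewrite -big_split; apply: eq_bigr => i _.
  by rewrite mulrDl.
- exists (fun i => b * a i); rewrite -[b *: _]/(b * _) mulr_sumr.
  by apply: eq_bigr => i _; rewrite mulrA.
Qed.

Lemma mul_span_range (Q : set A) m (h : 'I_m -> A) : is_ideal Q ->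
  ideal_mul Q (ideal_span (range h)) `<=`
  [set x | exists w : 'I_m -> A, (forall i, Q (w i)) /\ x = \sum_i w i * h i].
Proof.
move=> idQ; apply: mul_sub => [|q x Qq]; last first.
  rewrite span_range => -[a ->]; exists (fun i => q * a i); split=> [i|].
    by rewrite mulrC; apply: idealM.
  by rewrite mulr_sumr; apply: eq_bigr => i _; rewrite mulrA.
split=> [|_ _ [v [Qv ->]] [w [Qw ->]]|a _ [w [Qw ->]]].
- exists (fun=> 0); split=> [_|]; first exact: ideal0.
  by rewrite big1 // => i _; rewrite mul0r.
- exists (fun i => v i + w i); split=> [i|]; first exact: idealD.
  by rewrite -big_split; apply: eq_bigr => i _; rewrite mulrDl.
- exists (fun i => a * w i); split=> [i|]; first exact: idealM.
  by rewrite -[a *: _]/(a * _) mulr_sumr; apply: eq_bigr => i _; rewrite mulrA.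
Qed.

End IdealAlgebra.

(** * Local rings and Nakayama's lemma *)

Section LocalRings.
Variable A : comNzRingType.
Implicit Types (I J M N Q : set A) (x : A).

Definition invertible x : Prop := exists y, x * y = 1.

Definition nonunits : set A := [set x | ~ invertible x].

Lemma nonunit_proper I x : is_ideal I -> ~ I 1 -> I x -> nonunits x.
Proof. by move=> idI nI1 Ix [y xy1]; apply: nI1; rewrite -xy1 mulrC; apply: idealM. Qed.

(** Zorn's lemma for the proper ideals containing [x]. *)
Lemma nonunit_maximal x : nonunits x -> exists2 m, maximal_ideal m & m x.
Proof.
move=> nux; pose proper I := [/\ is_ideal I, I x & ~ I 1].
(* The empty set is admitted because the union of an empty chain is empty. *)
have [|M [Mp Mmax]] := @Zorn_bigcup A [set I | I = set0 \/ proper I].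
  move=> F FP Ftot; have [->|/set0P[y [I0 FI0 I0y]]] := eqVneq (\bigcup_(X in F) X) set0.
    by left.
  have Fprop I z : F I -> I z -> proper I by move=> /FP[->|].
  have [idI0 I0x _] := Fprop _ _ FI0 I0y.
  right; split; [|by exists I0|by move=> [I FI I1]; case: (Fprop _ _ FI I1)].
  split=> [|y1 y2 [I1 F1 Iy1] [I2 F2 Iy2]|a z [I FI Iz]].
  - by exists I0 => //; apply: ideal0.
  - have [[id1 _ _] [id2 _ _]] := (Fprop _ _ F1 Iy1, Fprop _ _ F2 Iy2).
    have [s12|s21] := Ftot _ _ F1 F2.
      by exists I2 => //; apply: idealD => //; apply: s12.
    by exists I1 => //; apply: idealD => //; apply: s21.
  - by exists I => //; have [idI _ _] := Fprop _ _ FI Iz; apply: idealM.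
have properX : proper [set a * x | a in setT].
  split; [exact: principal_ideal|by exists 1; rewrite ?mul1r|].
  by move=> [y _ yx1]; apply: nux; exists y; rewrite mulrC.
have {Mp}[idM Mx nM1] : proper M.
  case: Mp => // M0; exfalso; apply: (Mmax [set a * x | a in setT]); last by right.
  by rewrite M0; split=> // /(_ x); apply; exists 1; rewrite ?mul1r.
exists M => //; split=> // [MT|I idI MI]; first by apply: nM1; rewrite MT.
have [I1|nI1] := pselect (I 1); first by right; apply: ideal_eqT.
left; apply: contrapT => IM; apply: (Mmax I); last by right; split=> //; apply: MI.
by split=> // IM'; apply: IM; apply/seteqP.
Qed.

Lemma nonunits_ideal : local_ring A -> is_ideal nonunits.
Proof.
move=> [m [[idm mT mmax] uniq_m]].
suff -> : nonunits = m by [].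
apply/seteqP; split=> [x /nonunit_maximal[m' max_m' m'x]|x mx].
  by rewrite (uniq_m _ max_m').
by apply: (nonunit_proper idm) mx => m1; apply: mT; apply: ideal_eqT.
Qed.

Lemma local_1B x : local_ring A -> nonunits x -> invertible (1 - x).
Proof.
move=> locA nux; apply: contrapT => nu1x.
have : nonunits (x + (1 - x)) by apply: idealD (nonunits_ideal locA) _ _.
by rewrite addrC subrK; apply; exists 1; rewrite mulr1.
Qed.

(** The generators of [M] are discarded one at a time: modulo [N] and the
    other generators, a generator [g] satisfies [(1 - q) * g = 0] with [q] a
    nonunit, and [1 - q] is invertible. *)
Lemma nakayama M N Q : local_ring A -> noetherian_ring A ->
  is_ideal M -> is_ideal N -> Q `<=` nonunits ->
  M `<=` ideal_add N (ideal_mul Q M) -> M `<=` N.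
Proof.
move=> locA noethA idM idN Qnu MNQ; have [s defM] := noethA _ idM.
have : M `<=` ideal_add N (ideal_span [set` s]).
  by rewrite -defM; apply: add_subr.
have : [set` s] `<=` M by rewrite defM; apply: sub_ideal_span.
elim: s {defM} => [|g s IH] sM MNs.
  move=> x /MNs[y [z [Ny z0 ->]]]; apply: idealD => //.
  by apply: ideal_span_sub z0 => // u; rewrite /= in_nil.
have idNs : is_ideal (ideal_add N (ideal_span [set` s])).
  by apply: add_ideal => //; apply: span_ideal.
apply: IH => [x xs|]; first by apply: sM; rewrite /= inE xs orbT.
have Nsg x : M x -> exists y a, ideal_add N (ideal_span [set` s]) y /\ x = y + a * g.
  move=> /MNs[n [u [Nn /span_cons_sub[v [_ [sv [a _ <-] ->]]] ->]]].
  by exists (n + v), a; rewrite addrA; split=> //; exists n, v.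
have [y [q [Nsy nuq defg]]] : exists y q,
    [/\ ideal_add N (ideal_span [set` s]) y, nonunits q & g = y + q * g].
  have Mg : M g by apply: sM; rewrite /= mem_head.
  have [n [u [Nn QMu gnu]]] := MNQ _ Mg.
  suff [y [q [Nsy nuq uyq]]] : exists y q,
      [/\ ideal_add N (ideal_span [set` s]) y, nonunits q & u = y + q * g].
    exists (n + y), q; rewrite -addrA -uyq; split=> //.
    by apply: idealD => //; apply: add_subl => //; apply: span_ideal.
  move: u QMu {gnu}; apply: mul_sub => [|p x Qp /Nsg[y [a [Nsy ->]]]].
    split=> [|_ _ [y1 [q1 [? ? ->]]] [y2 [q2 [? ? ->]]]|a _ [y1 [q1 [? ? ->]]]].
    - exists 0, 0; rewrite mul0r addr0; split=> //; first exact: ideal0.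
      exact: ideal0 (nonunits_ideal locA).
    - exists (y1 + y2), (q1 + q2); split; [exact: idealD| |ring].
      exact: idealD (nonunits_ideal locA) _ _.
    - exists (a * y1), (a * q1); split; [exact: idealM| |].
        exact: idealM (nonunits_ideal locA) _.
      by rewrite -[a *: _]/(a * _) mulrDr mulrA.
  exists (p * y), (a * p); split; [exact: idealM| |ring].
  by apply: idealM (nonunits_ideal locA) _; apply: Qnu.
have Nsg' : ideal_add N (ideal_span [set` s]) g.
  have [w qw1] := local_1B locA nuq.
  suff -> : g = w * y by apply: idealM.
  have ygq : y = (1 - q) * g by rewrite mulrBl mul1r {1}defg addrK.
  by rewrite ygq mulrA (mulrC w) qw1 mul1r.
move=> x /Nsg[z [a [Nsz ->]]]; apply: idealD => //; exact: idealM.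
Qed.

(** A relation with an invertible coefficient would express one generator by
    the others, so any generating family of least size [n] will do. The family
    [h] is left arbitrary because minimality survives a change of generators
    that keeps their number. *)
Lemma minimal_generators J : noetherian_ring A -> is_ideal J ->
  exists n (g : 'I_n -> A), J = ideal_span (range g) /\
    forall h : 'I_n -> A, J = ideal_span (range h) ->
    forall a : 'I_n -> A, \sum_i a i * h i = 0 -> forall i, nonunits (a i).
Proof.
move=> noethA idJ; pose gen n := `[< exists g : 'I_n -> A, J = ideal_span (range g) >].
have exg : exists n, gen n.
  have [s Js] := noethA _ idJ; exists (size s); apply/asboolP.
  exists (fun i => s`_i); rewrite Js; congr ideal_span; apply/seteqP; split=> [x xs|_ [i _ <-]].
    by exists (Ordinal (etrans (index_mem x s) xs)); rewrite //= nth_index.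
  exact: mem_nth.
case: (ex_minnP exg) => n /asboolP[g Jg] minn; exists n, g; split=> // h Jh a a0 i.
move=> [b ab1].
case: n => [|n] in g Jg minn h Jh a a0 i ab1 *; first by case: i ab1.
suff : gen n by move=> /minn; rewrite ltnn.
apply/asboolP; exists (fun j => h (lift i j)); rewrite Jh.
apply/seteqP; split; last first.
  apply: ideal_span_sub (span_ideal _) _ => _ [j _ <-].
  by apply: sub_ideal_span; exists (lift i j).
apply: ideal_span_sub (span_ideal _) _ => _ [j _ <-].
have [j' ->|->] := unliftP i j; first by apply: sub_ideal_span; exists j'.
rewrite (bigD1_ord i) //= in a0; have /eqP := a0; rewrite addr_eq0 => /eqP hi.
have -> : h i = b * (a i * h i) by rewrite mulrA (mulrC b) ab1 mul1r.
rewrite hi -mulN1r mulrA; apply: idealM (span_ideal _) _.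
apply: ideal_sum (span_ideal _) _ => k; apply: idealM (span_ideal _) _.
by apply: sub_ideal_span; exists k.
Qed.

End LocalRings.

Arguments nonunits {A}.

(** * Reductions and extension of ideals *)

Section Reductions.
Variable A : comNzRingType.
Implicit Types I J : set A.

(** For large [j] this places high powers of [I] inside high powers of [J]. *)
Lemma reduction_expD I J p j : ideal_exp I p.+1 = ideal_mul J (ideal_exp I p) ->
  ideal_exp I (j + p) = ideal_mul (ideal_exp J j) (ideal_exp I p).
Proof.
move=> IJ; elim: j => [|j IH]; first by rewrite /= mul1_ideal //; apply: exp_ideal.
rewrite addSn /= IH (mulCA_ideal I) -[ideal_mul I _]/(ideal_exp I p.+1) IJ.
by rewrite mulCA_ideal mulA_ideal.
Qed.

Lemma reduction_setT J : reduction J setT -> J = setT.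
Proof.
by case=> idJ _ [n _]; rewrite !expT_ideal mulC_ideal mul1_ideal.
Qed.

Lemma reduction_refl I : is_ideal I -> reduction I I.
Proof. by move=> idI; split=> //; exists 1%N. Qed.

Lemma minimal_reduction_setT J : minimal_reduction J (setT : set A) <-> J = setT.
Proof.
split=> [[/reduction_setT]//|->]; split=> [|J' /reduction_setT//].
exact: reduction_refl (@idealT A).
Qed.

Lemma leastP (Q : set nat) n : Q n -> Q (least Q) /\ (least Q <= n)%N.
Proof.
move=> Qn; rewrite /least; case: xgetP => [m _ [Qm minm]|nex].
  by split=> //; apply: minm.
have ex : exists m, `[< Q m >] by exists n; apply/asboolP.
case: (ex_minnP ex) => m /asboolP Qm minm; exfalso; apply: (nex m).
by split=> // k Qk; apply: minm; apply/asboolP.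
Qed.

Lemma least_set0 : least set0 = 0%N.
Proof. by rewrite /least; case: xgetP => // m _ []. Qed.

Lemma reduction_number_wrt_eq J I : reduction J I ->
  let n := reduction_number_wrt J I in
  ideal_exp I n.+1 = ideal_mul J (ideal_exp I n).
Proof. case=> _ _ [n _ nP].
exact: (@leastP [set k | ideal_exp I k.+1 = ideal_mul J (ideal_exp I k)] n nP).1. Qed.

Lemma reduction_number_le J I n : minimal_reduction J I ->
  ideal_exp I n.+1 = ideal_mul J (ideal_exp I n) -> (reduction_number I <= n)%N.
Proof.
move=> Jmin Jn; apply: (@leq_trans (reduction_number_wrt J I)).
  by apply: (@leastP _ (reduction_number_wrt J I) _).2; exists J.
exact: (@leastP [set k | ideal_exp I k.+1 = ideal_mul J (ideal_exp I k)] n Jn).2.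
Qed.

(** The second case is the default value of [least] on the empty set; two
    ideals that both fall in it have equal reduction numbers. *)
Lemma reduction_numberP I :
  (exists2 J, minimal_reduction J I &
     let n := reduction_number I in ideal_exp I n.+1 = ideal_mul J (ideal_exp I n))
  \/ (forall J, ~ minimal_reduction J I) /\ reduction_number I = 0%N.
Proof.
have [[J Jmin]|nex] := pselect (exists J, minimal_reduction J I); [left|right].
  have [] : [set reduction_number_wrt J I | J in [set J | minimal_reduction J I]]
            (reduction_number I) by apply: (leastP (n := reduction_number_wrt J I) _).1; exists J.
  move=> J' J'min wrtE; exists J'; rewrite //= -wrtE; apply: reduction_number_wrt_eq.
  by case: J'min.
have none J : ~ minimal_reduction J I by move=> ?; apply: nex; exists J.
split=> //; rewrite /reduction_number -least_set0; congr least.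
by apply/seteqP; split=> // k [J /none].
Qed.

End Reductions.

Section Extensions.
Variables (S : comNzRingType) (P : {pred S}) (R : GRing.SubComNzRing.type P).
Implicit Types (I J : set R) (K : set S).

Lemma ext_ideal I : is_ideal (ideal_ext I).
Proof. exact: span_ideal. Qed.

Lemma mem_ext I x : I x -> ideal_ext I (val x).
Proof. by move=> Ix; apply: sub_ideal_span; exists x. Qed.

Lemma preim_ideal K : is_ideal K -> is_ideal (val @^-1` K : set R).
Proof.
move=> idK; split=> /= [|x y|a x]; first by rewrite rmorph0; apply: ideal0.
  by rewrite rmorphD; apply: idealD.
by rewrite rmorphM; apply: idealM.
Qed.

Lemma ext_sub I K : is_ideal K -> I `<=` val @^-1` K -> ideal_ext I `<=` K.
Proof. by move=> idK IK; apply: ideal_span_sub => // _ [x /IK ? <-]. Qed.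

Lemma ext_mono I J : I `<=` J -> ideal_ext I `<=` ideal_ext J.
Proof. by move=> IJ; apply: ext_sub (ext_ideal _) _ => x /IJ; apply: mem_ext. Qed.

Lemma ext_span (X : set R) : ideal_ext (ideal_span X) = ideal_span [set val x | x in X].
Proof.
apply/seteqP; split; last by apply: ext_mono; apply: sub_ideal_span.
apply: ext_sub (span_ideal _) _; apply: ideal_span_sub (preim_ideal (span_ideal _)) _.
by move=> x Xx; apply: sub_ideal_span; exists x.
Qed.

Lemma ext_mul I J : ideal_ext (ideal_mul I J) = ideal_mul (ideal_ext I) (ideal_ext J).
Proof.
apply/seteqP; split.
  apply: ext_sub (mul_ideal _ _) _.
  apply: mul_sub (preim_ideal (mul_ideal _ _)) _ => x y Ix Jy /=.
  by rewrite rmorphM; apply: mem_mul; apply: mem_ext.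
apply: mul_sub (ext_ideal _) _; apply: span_mul_sub (ext_ideal _) _.
move=> _ _ [x Ix <-] [y Jy <-]; rewrite -rmorphM; apply: mem_ext; exact: mem_mul.
Qed.

Lemma ext_setT : ideal_ext (setT : set R) = setT.
Proof.
apply: ideal_eqT (ext_ideal _) _; rewrite -(rmorph1 (val : R -> S)).
exact: mem_ext.
Qed.

Lemma ext_exp I n : ideal_ext (ideal_exp I n) = ideal_exp (ideal_ext I) n.
Proof. by elim: n => [|n IH] /=; [exact: ext_setT|rewrite ext_mul IH]. Qed.

Lemma ext_reduction_eq J I n : ideal_exp I n.+1 = ideal_mul J (ideal_exp I n) ->
  ideal_exp (ideal_ext I) n.+1 = ideal_mul (ideal_ext J) (ideal_exp (ideal_ext I) n).
Proof. by move=> IJ; rewrite -!ext_exp IJ ext_mul. Qed.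

Lemma ext_reduction J I : reduction J I -> reduction (ideal_ext J) (ideal_ext I).
Proof.
case=> _ JI [n n0 IJ]; split; [exact: ext_ideal|exact: ext_mono|].
by exists n => //; apply: ext_reduction_eq.
Qed.

End Extensions.

(** * The constants of a twisted subring *)

(** What the argument retains of a twisting derivation [D]: [A] is the ring of
    constants of [D] in [S], dense for the topology that the ideals [c S]
    define, and [P] is the subring twisted along [D]. *)
Record constants (S : comNzRingType) (P : {pred S}) (C : mulrClosed S)
    (A : set S) : Prop := Constants {
  const0 : A 0;
  constD : forall x y, A x -> A y -> A (x + y);
  constM : forall x y, A x -> A y -> A (x * y);
  constB : forall x y, A x -> A y -> A (x - y);
  const_denom : forall c, c \in C -> A c;
  const_twisted : forall x, A x -> x \in P;
  const_sat : forall c x, c \in C -> A (c * x) -> A x;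
  const_dense : forall c s, c \in C -> exists a t, A a /\ s = a + c * t;
  twisted_mul : forall c s t,
    c \in C -> c * s \in P -> c * t \in P -> c * (s * t) \in P;
  twisted_inv : forall s t, s \in P -> s * t = 1 -> t \in P }.

Section KernelOfTwist.
Variables (S : comNzRingType) (K : lmodType S) (C : mulrClosed S).
Implicit Types (s t c : S) (k l : K).

Lemma to_locD s t : to_loc C (s + t) = to_loc C s + to_loc C t.
Proof. by rewrite /to_loc locfrac_add; apply: eq_locfrac; rewrite /=; ring. Qed.

Lemma to_locM s t : to_loc C (s * t) = to_loc C s * to_loc C t.
Proof. by rewrite /to_loc locfrac_mul; apply: eq_locfrac; rewrite /=; ring. Qed.

Lemma to_modlocD k l : to_modloc C (k + l) = to_modloc C k + to_modloc C l.
Proof.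
by rewrite /to_modloc frac_add; apply: eq_frac; rewrite /= mulr1 !scale1r.
Qed.

Lemma to_modlocZ s k : to_modloc C (s *: k) = to_loc C s *: to_modloc C k.
Proof.
by rewrite /to_modloc /to_loc locfrac_scale; apply: eq_frac; rewrite /= mulr1.
Qed.

Lemma to_loc_reg c (v : modloc C K) : c \in C -> to_loc C c *: v = 0 -> v = 0.
Proof.
move=> Cc; elim/fracW: v => x d; rewrite /to_loc locfrac_scale => /fracP[u Cu].
rewrite /= scaler0 scaler0 scale1r => ucx; apply/fracP; exists (u * c).
  exact: rpredM.
by rewrite /= !scaler0 scale1r -scalerA.
Qed.

(** The last two conditions come from the Leibniz rule:
    [D (c * (s * t)) = s *: D (c * t) + t *: D (c * s)], and
    [D t = - (t * t) *: D s] when [s * t = 1]. *)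
Lemma twisted_constants (P : {pred S}) : twisted K C P ->
  exists A, constants P C A.
Proof.
case=> D [[DD DM] DC DP _ Ddense].
pose d s := D (to_loc C s).
have dD s t : d (s + t) = d s + d t by rewrite /d to_locD DD.
have dM s t : d (s * t) = to_loc C s *: d t + to_loc C t *: d s.
  by rewrite /d to_locM DM.
have d0 : d 0 = 0 by apply: (addrI (d 0)); rewrite -dD !addr0.
have dN s : d (- s) = - d s by apply/eqP; rewrite -addr_eq0 -dD addNr d0.
have dC c s : c \in C -> d (c * s) = to_loc C c *: d s.
  by move=> Cc; rewrite dM [d c]DC// scaler0 addr0.
exists [set s | d s = 0]; split=> /=.
- exact: d0.
- by move=> x y x0 y0; rewrite dD x0 y0 addr0.
- by move=> x y x0 y0; rewrite dM x0 y0 !scaler0 addr0.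
- by move=> x y x0 y0; rewrite dD dN x0 y0 subr0.
- by move=> c; apply: DC.
- by move=> x x0; apply/DP; exists 0; rewrite -[D _]/(d x) x0.
- by move=> c x Cc; rewrite dC//; apply: to_loc_reg.
- move=> c s Cc; have [x [t [x0 sx]]] := Ddense _ Cc s.
  exists (s - c * t), t; rewrite subrK; split=> //.
  have sE : to_loc C (s - c * t) = x.
    by apply: (addIr (to_loc C (c * t))); rewrite -sx -to_locD subrK.
  by rewrite /d sE.
- move=> c s t Cc /DP[k csk] /DP[l ctl]; apply/DP; exists (s *: l + t *: k).
  rewrite to_modlocD !to_modlocZ -csk -ctl -![D _]/(d _) !(dC c)// dM.
  by rewrite scalerDr !scalerA ![to_loc C c * _]mulrC.
- move=> s t /DP[k sk] st1; apply/DP; exists (- (t * t) *: k).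
  rewrite to_modlocZ -sk -![D _]/(d _).
  have /(congr1 (fun v => to_loc C t *: v)) : d (s * t) = 0.
    by rewrite st1; apply: DC; apply: rpred1.
  rewrite dM scaler0 scalerDr !scalerA -!to_locM (mulrC t s) st1 scale1r => /eqP.
  rewrite addr_eq0 => /eqP ->.
  rewrite -scaleNr; congr (_ *: _); apply/eqP.
  by rewrite eq_sym -subr_eq0 opprK -to_locD addNr.
Qed.

End KernelOfTwist.

Section Frame.
Variables (S : comNzRingType) (P : {pred S}) (R : GRing.SubComNzRing.type P).
Variables (C : mulrClosed S) (A : set S).
Hypothesis constA : constants P C A.
Implicit Types (I J M N L : set R) (X : set S).

Lemma liftP s : s \in P -> exists r : R, val r = s.
Proof. by move=> Ps; exists (Sub s Ps); rewrite SubK. Qed.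

Lemma const_lift a : A a -> exists r : R, val r = a.
Proof. by move=> /(const_twisted constA)/liftP. Qed.

(** With the converse below, the maximal ideal of [S] lies over that of [R]. *)
Lemma nonunits_val (r : R) : nonunits r -> nonunits (val r).
Proof.
move=> nur [t rt1]; apply: nur.
have [r' r't] : exists r' : R, val r' = t.
  by apply: liftP; apply: (twisted_inv constA) rt1; apply: valP.
by exists r'; apply: val_inj; rewrite rmorphM /= r't rt1 rmorph1.
Qed.

Lemma nonunits_of_val (r : R) : nonunits (val r) -> nonunits r.
Proof.
by move=> nur [r' rr']; apply: nur; exists (val r'); rewrite -rmorphM rr' rmorph1.
Qed.

(** By density a scalar [s = a + c * t] of [S] acts as the constant [a] up to a
    multiple of [c], and [X] is stable under constants. *)
Lemma span_descent X c : c \in C -> X 0 ->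
  (forall x y, X x -> X y -> X (x + y)) -> (forall a x, A a -> X x -> X (a * x)) ->
  forall y, ideal_span X y -> exists v t, [/\ X v, ideal_span X t & y = v + c * t].
Proof.
move=> Cc X0 XD XM.
have idX : is_ideal (ideal_span X) by exact: span_ideal.
apply: ideal_span_sub => [|x Xx]; last first.
  by exists x, 0; rewrite mulr0 addr0; split=> //; apply: ideal0.
split=> [|_ _ [v [t [? ? ->]]] [v' [t' [? ? ->]]]|s _ [v [t [Xv Xt ->]]]].
- by exists 0, 0; rewrite mulr0 addr0; split=> //; apply: ideal0.
- exists (v + v'), (t + t'); split; [exact: XD|exact: (idealD idX)|ring].
- have [a [u [Aa ->]]] := const_dense constA s Cc.
  exists (a * v), (u * v + (a + c * u) * t); split; [exact: XM| |].
    by apply: (idealD idX); apply: (idealM _ idX) => //; apply: sub_ideal_span.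
  by rewrite -[_ *: _]/((a + c * u) * _); ring.
Qed.

Lemma ext_descent M c y : c \in C -> is_ideal M -> ideal_ext M y ->
  exists v t, [/\ M v, ideal_ext M t & y = val v + c * t].
Proof.
move=> Cc idM My.
have [|||_ [t [[v Mv <-] Mt yE]]] := @span_descent [set val x | x in M] c Cc _ _ _ y My.
- by exists 0; rewrite ?rmorph0 //; apply: ideal0.
- move=> _ _ [x Mx <-] [z Mz <-].
  by exists (x + z); [apply: idealD|rewrite rmorphD].
- move=> _ _ /const_lift[a <-] [x Mx <-].
  by exists (a * x); [apply: idealM|rewrite rmorphM].
by exists v, t.
Qed.

Definition const_part M : set R := [set r | M r /\ A (val r)].

(** For these ideals, descending a constant from the extension leaves an error
    in [c R] and not just in [c S]; see [const_descent]. *)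
Definition const_generated M : Prop := is_ideal M /\ M `<=` ideal_span (const_part M).

Lemma const_generated_span (X : set R) :
  (forall x, X x -> A (val x)) -> const_generated (ideal_span X).
Proof.
move=> XA; split; first exact: span_ideal.
apply: ideal_span_sub (span_ideal _) _ => x Xx; apply: sub_ideal_span.
by split; [apply: sub_ideal_span|apply: XA].
Qed.

Lemma const_generated_mul M N :
  const_generated M -> const_generated N -> const_generated (ideal_mul M N).
Proof.
move=> [idM MA] [idN NA]; split; first exact: mul_ideal.
apply: mul_sub (span_ideal _) _ => x y /MA Mx /NA Ny.
apply: (span_mul_sub (span_ideal _) _ Mx Ny) => {Mx Ny} u v [Mu Au] [Nv Av].
apply: sub_ideal_span; split; first exact: mem_mul.
by rewrite rmorphM; apply: (constM constA).
Qed.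

Lemma const_generated_exp M n : const_generated M -> const_generated (ideal_exp M n).
Proof.
move=> MA; elim: n => [|n IH] /=; last exact: const_generated_mul.
split; first exact: idealT.
have A1 : A 1 by apply: (const_denom constA); apply: rpred1.
rewrite [ideal_span _]ideal_eqT //; first exact: span_ideal.
by apply: sub_ideal_span; split; rewrite ?rmorph1.
Qed.

(** When the element [p] of the extension is itself a constant, the error term
    of [span_descent] is a constant multiple of [c], so it lies in [c R] and not
    just in [c S]. *)
Lemma const_descent M c p : c \in C -> const_generated M -> A (val p) ->
  ideal_ext M (val p) -> exists v r (c' : R), [/\ M v, val c' = c & p = v + c' * r].
Proof.
move=> Cc [idM MA] Ap Mp; have [c' c'E] := const_lift (const_denom constA Cc).
have {}Mp : ideal_span [set val x | x in const_part M] (val p).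
  by rewrite -ext_span; apply: ext_mono Mp.
have [|||_ [t [[v [Mv Av] <-] _ pE]]] :=
    @span_descent [set val x | x in const_part M] c Cc _ _ _ _ Mp.
- exists 0; rewrite ?rmorph0 //; split; first exact: ideal0.
  by rewrite rmorph0; apply: (const0 constA).
- move=> _ _ [x [Mx Ax] <-] [z [Mz Az] <-]; exists (x + z); rewrite ?rmorphD //.
  by split; [apply: idealD|rewrite rmorphD; apply: (constD constA)].
- move=> a0 _ Aa [x [Mx Ax] <-]; have [a aE] := const_lift Aa.
  exists (a * x); rewrite ?rmorphM /= ?aE //.
  by split; [apply: idealM|rewrite rmorphM /= aE; apply: (constM constA)].
have [r rE] : exists r : R, val r = t.
  apply: const_lift; apply: (const_sat constA Cc).
  have -> : c * t = val p - val v by rewrite pE addrAC subrr add0r.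
  exact: (constB constA).
by exists v, r, c'; split=> //; apply: val_inj; rewrite rmorphD rmorphM /= c'E rE.
Qed.

End Frame.

(** * Contracted ideals meeting the denominators *)

Section Contracted.
Variables (S : comNzRingType) (P : {pred S}) (R : GRing.SubComNzRing.type P).
Variables (C : mulrClosed S) (A : set S).
Hypothesis constA : constants P C A.
Hypotheses (R_local : local_ring R) (R_noeth : noetherian_ring R).
Hypotheses (S_local : local_ring S) (S_noeth : noetherian_ring S).
Variables (I : set R) (c : R).
Hypotheses (I_ideal : is_ideal I) (I_contracted : contracted I).
Hypotheses (Ic : I c) (Cc : val c \in C) (nI1 : ~ I 1).
Implicit Types (J : set S) (L M Z : set R).

Let b : set R := ideal_span (const_part A I).

(** All of [c S] is in the extension of [I]. *)
Lemma mem_contracted (w : R) t : val w = val c * t -> I w.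
Proof.
move=> wct; rewrite I_contracted /= wct mulrC.
by apply: (idealM _ (ext_ideal I)); apply: mem_ext.
Qed.

Lemma contracted_nonunits : I `<=` nonunits.
Proof. by move=> x; apply: nonunit_proper. Qed.

Lemma nonunits_c : nonunits (val c).
Proof. by apply: (nonunits_val constA); apply: contracted_nonunits. Qed.

Lemma Ac : A (val c).
Proof. exact: (const_denom constA). Qed.

Lemma Cc_exp n : val c ^+ n \in C.
Proof. exact: rpredX. Qed.

(** Density of the constants. The error [u] is an element of [R] in [c S], but
    in general not in [c R]. *)
Lemma contracted_split (y : R) : I y ->
  exists a u t, [/\ const_part A I a, I u, val u = val c * t & y = a + u].
Proof.
move=> Iy; have [x [t [Ax yat]]] := const_dense constA (val y) Cc.
have [a ax] := const_lift R constA Ax; rewrite -{}ax in Ax yat.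
have uct : val (y - a) = val c * t by rewrite rmorphB /= yat addrC addKr.
have Iu := mem_contracted uct.
exists a, (y - a), t; split=> //; last by rewrite addrC subrK.
by split=> //; rewrite -(subKr y a); apply: idealB.
Qed.

(** Elements of [R] in [d S] need not be multiples of [d] in [R], but their
    products are, and the cofactor [w] lies in [d S] again. *)
Lemma sqr_error (d : R) (u v : R) s t : val d \in C ->
  val u = val d * s -> val v = val d * t ->
  exists w, u * v = d * w /\ val w = val d * (s * t).
Proof.
move=> Cd uds vdt; have [w wE] : exists w : R, val w = val d * (s * t).
  apply: liftP; apply: (twisted_mul constA Cd); first by rewrite -uds; apply: valP.
  by rewrite -vdt; apply: valP.
exists w; split=> //; apply: val_inj; rewrite !rmorphM /= uds vdt wE; ring.
Qed.

(** Of the four products that arise from splitting two elements of [I], the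
    product of two errors is in [c I], and [c] is itself in [b]; the others
    have a factor in [b]. *)
Lemma contracted_sqr : ideal_mul I I `<=` ideal_mul b I.
Proof.
apply: mul_sub (mul_ideal _ _) _ => y z Iy Iz.
have [a [u [s [Ia Iu us ->]]]] := contracted_split Iy.
have [a' [v [t [Ia' Iv vt zE]]]] := contracted_split Iz.
have ba r : const_part A I r -> b r by apply: sub_ideal_span.
have [w [uvE wE]] := sqr_error Cc us vt.
have -> : (a + u) * z = a * z + (a' * u + c * w) by rewrite -uvE zE; ring.
apply: (idealD (mul_ideal _ _)); first by apply: mem_mul => //; apply: ba.
apply: (idealD (mul_ideal _ _)); first by apply: mem_mul => //; apply: ba.
apply: mem_mul; first by apply: ba; split=> //; exact: Ac.
exact: mem_contracted wE.
Qed.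

Lemma contracted_exp n : ideal_exp I n.+2 `<=` ideal_mul (ideal_exp b n.+1) I.
Proof.
elim: n => [|n IH].
  rewrite /= ![ideal_mul _ setT]mulC_ideal !mul1_ideal //; last exact: span_ideal.
  exact: contracted_sqr.
rewrite -[ideal_exp I _]/(ideal_mul I (ideal_exp I n.+2)) => x Ix.
have {}Ix := mul_mono (@subset_refl _ I) IH Ix.
rewrite mulCA_ideal in Ix; have {Ix} := mul_mono (@subset_refl _ _) contracted_sqr Ix.
by rewrite mulCA_ideal mulA_ideal.
Qed.

(** The errors lie in [c S], and [c] belongs to [b]. *)
Lemma ext_const_part : ideal_ext b = ideal_ext I.
Proof.
apply/seteqP; split; apply: ext_sub (ext_ideal _) _.
  by apply: ideal_span_sub (preim_ideal _ (ext_ideal _)) _ => x [Ix _]; apply: mem_ext.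
move=> y Iy /=; have [a [u [t [Ia Iu uE ->]]]] := contracted_split Iy.
rewrite rmorphD /= uE; apply: (idealD (ext_ideal _)).
  by apply: mem_ext; apply: sub_ideal_span.
rewrite mulrC; apply: (idealM _ (ext_ideal _)); apply: mem_ext; apply: sub_ideal_span.
by split=> //; exact: Ac.
Qed.

(** The loss of one power of [I] is the factor [z] taken out by
    [contracted_exp]: only the constant part [p] of degree [n + 1] can be
    descended from [S] to [R]. *)
Lemma reduction_descent (J : set R) n : const_generated A J -> J `<=` I ->
  ideal_ext (ideal_exp I n.+1) = ideal_mul (ideal_ext J) (ideal_ext (ideal_exp I n)) ->
  ideal_exp I n.+2 = ideal_mul J (ideal_exp I n.+1).
Proof.
move=> JA JI In; apply/seteqP; split; last exact: mul_mono.
have idb : const_generated A b by apply: const_generated_span => x [].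
have bI : b `<=` I by apply: ideal_span_sub => // x [].
apply: (@nakayama _ _ _ I) => //; [exact: mul_ideal..|exact: contracted_nonunits|].
set K := ideal_add _ _.
have idK : is_ideal K by apply: add_ideal; apply: mul_ideal.
move=> x /contracted_exp; apply: mul_sub x => // p z bp Iz.
have [_ bA] := const_generated_exp constA n.+1 idb.
apply: (ideal_span_sub (ideal_colon z idK)) (bA _ bp) => {bp}p [bp Ap] /=.
have Jp : ideal_ext (ideal_mul J (ideal_exp b n)) (val p).
  rewrite ext_mul ext_exp ext_const_part -ext_exp -In ext_exp -ext_const_part -ext_exp.
  exact: mem_ext.
have [v [r [d [Jv dE ->]]]] := const_descent constA (Cc_exp n.+2)
  (const_generated_mul constA JA (const_generated_exp constA n idb)) Ap Jp.
(* The exponent n + 2 makes the error term lie in the ideal I * I ^ (n + 2)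
   that Nakayama's lemma absorbs. *)
have {d dE}-> : d = c ^+ n.+2 by apply: val_inj; rewrite dE rmorphXn.
exists (v * z), (z * r * c ^+ n.+2); split; last ring.
  have : ideal_mul (ideal_mul J (ideal_exp b n)) I (v * z) by apply: mem_mul.
  rewrite -mulA_ideal; apply: mul_mono => // y.
  by rewrite mulC_ideal; apply: mul_mono => //; apply: exp_mono.
by apply: mem_mul; [rewrite mulrC; apply: idealM|apply: mem_exp].
Qed.

(** A minimal family of generators of [J] is moved into the constants by
    multiples of [c ^ (k + 1)]; these lie in [m J], so by Nakayama's lemma the
    new family still generates [J]. The last clause says that [L / m L] embeds
    in [J / m J]: minimality of the generators forces any two expressions of
    one element to have the same coefficients modulo the maximal ideal of [S]. *)
Lemma lift_generators J k : is_ideal J -> J `<=` ideal_ext I -> J (val c ^+ k) ->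
  exists L, [/\ const_generated A L, L `<=` I, ideal_ext L = J &
    forall y, L y -> ideal_mul nonunits J (val y) -> ideal_mul nonunits L y].
Proof.
move=> idJ JI Jck; have [m [g [Jg minJ]]] := minimal_generators S_noeth idJ.
have Jg_i i : J (g i) by rewrite Jg; apply: sub_ideal_span; exists i.
have /choice[f fP] i : exists a : R, A (val a) /\ exists t, g i = val a + val c ^+ k.+1 * t.
  have [x [t [Ax giE]]] := const_dense constA (g i) (Cc_exp k.+1).
  have [a ax] := const_lift R constA Ax; rewrite -{}ax in Ax giE.
  by exists a; split=> //; exists t.
have Jf i : J (val (f i)).
  have [_ [t giE]] := fP i; have -> : val (f i) = g i - (val c * t) * val c ^+ k.
    by rewrite giE exprS; ring.
  by apply: (idealB idJ) => //; apply: idealM.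
have extL : ideal_ext (ideal_span (range f)) = J.
  apply/seteqP; split.
    by apply: ext_sub => //; apply: ideal_span_sub (preim_ideal _ idJ) _ => _ [i _ <-]; apply: Jf.
  apply: (@nakayama _ _ _ nonunits) => //; first exact: ext_ideal.
  have idK : is_ideal (ideal_add (ideal_ext (ideal_span (range f))) (ideal_mul nonunits J)).
    by apply: add_ideal; [apply: ext_ideal|apply: mul_ideal].
  rewrite [X in X `<=` _]Jg; apply: ideal_span_sub => // _ [i _ <-].
  have [_ [t giE]] := fP i; exists (val (f i)), (val c * (t * val c ^+ k)); split.
  - by apply: mem_ext; apply: sub_ideal_span; exists i.
  - by apply: mem_mul; [exact: nonunits_c|apply: idealM].
  - by rewrite giE exprS; ring.
have Jf_range : J = ideal_span (range (fun i => val (f i))).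
  rewrite -extL ext_span; congr ideal_span.
  apply/seteqP; split=> [_ [_ [i _ <-] <-]|_ [i _ <-]]; first by exists i.
  by exists (f i) => //; exists i.
exists (ideal_span (range f)); split=> //.
- by apply: const_generated_span => _ [i _ <-]; case: (fP i).
- apply: ideal_span_sub => // _ [i _ <-]; rewrite I_contracted /=.
  by apply: JI; apply: Jf.
move=> y; rewrite {1}span_range => -[a yE].
rewrite Jf_range => /(mul_span_range (nonunits_ideal S_local))[w [nuw wE]].
have rel : \sum_i (val (a i) - w i) * val (f i) = 0.
  under eq_bigr => i _ do rewrite mulrBl.
  rewrite sumrB -wE yE rmorph_sum; apply/eqP; rewrite subr_eq0; apply/eqP.
  by apply: eq_bigr => i _; rewrite rmorphM.
rewrite yE; apply: (ideal_sum (mul_ideal _ _)) => i.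
apply: mem_mul; last by apply: sub_ideal_span; exists i.
apply: nonunits_of_val; rewrite -(subrK (w i) (val (a i))).
apply: (idealD (nonunits_ideal S_local)) => //.
exact: (minJ _ Jf_range (fun i => val (a i) - w i) rel i).
Qed.

(** For a reduction [M] of [J'], minimality of [J] makes [M] and [J'] have the
    same extension, and then [M = J'] because [J' / m J'] embeds in [J / m J]. *)
Lemma reduction_lift J n : minimal_reduction J (ideal_ext I) ->
  ideal_ext (ideal_exp I n.+1) = ideal_mul J (ideal_ext (ideal_exp I n)) ->
  exists2 J' : set R, minimal_reduction J' I &
    ideal_exp I n.+2 = ideal_mul J' (ideal_exp I n.+1).
Proof.
move=> [[idJ JI _] minJ] In.
have Jcn : J (val c ^+ n.+1).
  suff : ideal_ext (ideal_exp I n.+1) (val c ^+ n.+1).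
    by rewrite In; apply: mul_subl.
  by rewrite ext_exp; apply: mem_exp; apply: mem_ext.
have [L [LA LI extL L_nu]] := lift_generators idJ JI Jcn.
have In2 : ideal_exp I n.+2 = ideal_mul L (ideal_exp I n.+1).
  by apply: reduction_descent => //; rewrite extL.
exists L => //; have idL : is_ideal L by case: LA.
split=> [|M ML]; first by split=> //; exists n.+1.
have extM : ideal_ext M = J by apply: minJ; rewrite -extL; apply: ext_reduction.
case: ML => idM ML _; apply/seteqP; split=> //.
apply: (@nakayama _ _ _ nonunits) => // y Ly.
have : ideal_ext M (val y) by rewrite extM -extL; apply: mem_ext.
move=> /(ext_descent constA Cc idM)[v [t [Mv Mt yE]]].
exists v, (y - v); split=> //; last by rewrite addrC subrK.
apply: L_nu; first by apply: (idealB idL) => //; apply: ML.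
rewrite rmorphB /= yE addrC addKr -extM; apply: mem_mul => //; exact: nonunits_c.
Qed.

(** Here [J] need not be contracted and its generators need not be constants.
    A reduction [L] of the extension is the extension of [Z], the preimage of
    [L] in [J]; that [Z] reduces [J] is visible on a square of powers of [J],
    where the errors of the descent are multiplied in pairs and become
    elements of a high power of [I], hence of [J]. *)
Lemma reduction_ext_minimal (J : set R) : minimal_reduction J I ->
  minimal_reduction (ideal_ext J) (ideal_ext I).
Proof.
move=> [Jred minJ]; split; first exact: ext_reduction.
have [idJ JI [p _ Ip]] := Jred => L [idL LJ [q q0 Lq]].
pose N := (p.+1 * q.+1)%N.
have Jcp : J (c ^+ p.+1).
  suff : ideal_exp I p.+1 (c ^+ p.+1) by rewrite Ip; apply: mul_subl.
  exact: mem_exp.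
have LcN : L (val c ^+ N).
  suff : ideal_exp (ideal_ext J) q.+1 (val c ^+ N) by rewrite Lq; apply: mul_subl.
  by rewrite exprM; apply: mem_exp; rewrite -rmorphXn; apply: mem_ext.
(* The summand N puts c ^ (k + 1) S inside c L; the other one makes
   I ^ (k + 2) lie in J ^ (2 q + 3), one power above the square of
   J ^ (q + 1). *)
pose k := (N + (p + (q.+1 + q.+1).+1))%N.
have Lck t : exists2 u, L u & val c ^+ k.+1 * t = val c * u.
  exists (val c ^+ (k - N) * t * val c ^+ N); first exact: idealM.
  have -> : val c ^+ k.+1 = val c * (val c ^+ (k - N) * val c ^+ N).
    by rewrite -exprD subnK ?leq_addr // exprS.
  by rewrite -!mulrA [_ * t]mulrC.
pose Z : set R := [set z | J z /\ L (val z)].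
have idZ : is_ideal Z.
  split=> [|x y [Jx Lx] [Jy Ly]|a x [Jx Lx]].
  - by split; [apply: ideal0|rewrite rmorph0; apply: ideal0].
  - by split; [apply: idealD|rewrite rmorphD; apply: idealD].
  - by split; [apply: idealM|rewrite rmorphM; apply: idealM].
have extZ : ideal_ext Z = L.
  apply/seteqP; split; first by apply: ext_sub => // z [].
  apply: (@nakayama _ _ _ nonunits) => //; first exact: ext_ideal.
  move=> x Lx; have [z [t [Jz _ xE]]] := ext_descent constA (Cc_exp k.+1) idJ (LJ _ Lx).
  have [u Lu uE] := Lck t; rewrite uE in xE.
  exists (val z), (val c * u); split=> //; last by apply: mem_mul => //; exact: nonunits_c.
  apply: mem_ext; split=> //; have -> : val z = x - val c * u by rewrite xE addrK.
  by apply: (idealB idL) => //; apply: idealM.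
suff ZJ : reduction Z J by rewrite -extZ (minJ _ ZJ).
split=> // [z []//|]; exists (q.+1 + q)%N => //.
set Q := ideal_exp J q.+1.
have idZJ : is_ideal (ideal_mul Z (ideal_exp J (q.+1 + q))) by exact: mul_ideal.
have QZ y : Q y -> exists v w t, [/\ ideal_mul Z (ideal_exp J q) v, Q w,
    val w = val (c ^+ k.+1) * t & y = v + w].
  move=> Qy; have : ideal_ext (ideal_mul Z (ideal_exp J q)) (val y).
    by rewrite ext_mul extZ ext_exp -Lq -ext_exp; apply: mem_ext.
  move=> /(ext_descent constA (Cc_exp k.+1) (mul_ideal _ _))[v [t [Zv _ yE]]].
  exists v, (y - v), t; split=> //; last by rewrite addrC subrK.
    apply: (idealB (exp_ideal _ _)) => //.
    by apply: (mul_mono _ (@subset_refl _ _) Zv) => z [].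
  by rewrite rmorphB /= yE addrC addKr rmorphXn.
have ZJQ : ideal_mul Z (ideal_exp J (q.+1 + q)) = ideal_mul (ideal_mul Z (ideal_exp J q)) Q.
  by rewrite addnC expD_ideal mulA_ideal.
apply/seteqP; split; last by apply: mul_mono => // z [].
have -> : (q.+1 + q).+1 = (q.+1 + q.+1)%N by rewrite addnS.
apply: (@nakayama _ _ _ I) => //; [exact: exp_ideal|exact: contracted_nonunits|].
set K := ideal_add _ _.
have idK : is_ideal K by apply: add_ideal => //; apply: mul_ideal.
rewrite {1}expD_ideal; apply: mul_sub => // y y' Qy Qy'.
have [v [w [t [Zv Qw wt ->]]]] := QZ _ Qy.
have [v' [w' [t' [Zv' Qw' wt' yE']]]] := QZ _ Qy'.
have Cck : val (c ^+ k.+1) \in C by rewrite rmorphXn; apply: Cc_exp.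
have [e [ee' eE]] := sqr_error Cck wt wt'.
exists (v * y' + v' * w), (c ^+ k.+1 * e); split; last by rewrite -ee' yE'; ring.
  by rewrite ZJQ; apply: (idealD (mul_ideal _ _)); apply: mem_mul.
have : ideal_exp I (k.+1 + 1) (c ^+ k.+1 * e).
  rewrite expD_ideal; apply: mem_mul; first exact: mem_exp.
  rewrite /= mulC_ideal mul1_ideal //; apply: (mem_contracted (t := val c ^+ k * (t * t'))).
  by rewrite eE rmorphXn /= exprS -!mulrA.
have kE : ((q.+1 + q.+1).+1 + p <= k.+1 + 1)%N by rewrite /k; lia.
move=> /(exp_antitone kE); rewrite (reduction_expD _ Ip).
move=> /(mul_subl (exp_ideal _ _)); apply: (mul_mono JI); exact: subset_refl.
Qed.

End Contracted.

Theorem corollary3p4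
  (S : comNzRingType) (P : {pred S}) (R : GRing.SubComNzRing.type P)
  (K : lmodType S) (C : mulrClosed S)
  (R_local : local_ring R) (R_noeth : noetherian_ring R)
  (R_inf : infinite_residue_field R)
  (S_local : local_ring S) (S_noeth : noetherian_ring S)
  (S_inf : infinite_residue_field S)
  (C_regS : forall c, c \in C -> GRing.lreg c)
  (C_regK : forall c, c \in C -> forall k : K, c *: k = 0 -> k = 0)
  (R_twisted : twisted K C P)
  (I : set R) (I_ideal : is_ideal I) (I_contracted : contracted I)
  (I_meets_C : exists2 x : R, I x & val x \in C) :
  (forall (J : set S) (n : nat),
     minimal_reduction J (ideal_ext I) ->
     ideal_ext (ideal_exp I n.+1) = ideal_mul J (ideal_ext (ideal_exp I n)) ->
     exists2 J' : set R, minimal_reduction J' I &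
       ideal_exp I n.+2 = ideal_mul J' (ideal_exp I n.+1)) /\
  (reduction_number (ideal_ext I) <= reduction_number I
     <= (reduction_number (ideal_ext I)).+1)%N.
Proof.
have [A constA] := twisted_constants R_twisted.
have [c Ic Cc] := I_meets_C.
have lift J n : minimal_reduction J (ideal_ext I) ->
     ideal_ext (ideal_exp I n.+1) = ideal_mul J (ideal_ext (ideal_exp I n)) ->
     exists2 J' : set R, minimal_reduction J' I &
       ideal_exp I n.+2 = ideal_mul J' (ideal_exp I n.+1).
  have [I1|nI1] := pselect (I 1); last exact: (reduction_lift constA _ _ _ _ _ _ Ic).
  rewrite (ideal_eqT I_ideal I1) => _ _; exists setT; first exact/minimal_reduction_setT.
  by rewrite -[ideal_exp _ n.+2]/(ideal_mul setT _).
have ext_min J' : minimal_reduction J' I -> minimal_reduction (ideal_ext J') (ideal_ext I).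
  have [I1|nI1] := pselect (I 1); last exact: (reduction_ext_minimal constA _ _ _ _ _ _ Ic).
  rewrite (ideal_eqT I_ideal I1) => /minimal_reduction_setT ->; rewrite ext_setT.
  exact/minimal_reduction_setT.
split=> //; apply/andP; split.
- have [[J' J'min J'n]|[none _]] := reduction_numberP I.
    exact: reduction_number_le (ext_min _ J'min) (ext_reduction_eq J'n).
  have [[J Jmin Jn]|[_ -> //]] := reduction_numberP (ideal_ext I).
  have [|J' /none//] := lift _ (reduction_number (ideal_ext I)) Jmin.
  by rewrite !ext_exp; apply: Jn.
- have [[J Jmin Jn]|[none _]] := reduction_numberP (ideal_ext I).
    have [|J' J'min J'n] := lift _ (reduction_number (ideal_ext I)) Jmin.
      by rewrite !ext_exp; apply: Jn.
    exact: reduction_number_le J'min J'n.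
  have [[J' J'min _]|[_ -> //]] := reduction_numberP I.
  by case: (none _ (ext_min _ J'min)).
Qed.
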